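(* Let $d>0$, and let $w>0$ and $h>0$ satisfy $$\max\left\{ w,\ \operatorname{arccosh}\left(1+\frac{2(\cosh(w)-1)+(e^h-1)^2}{2e^h}\right)\right\}\leq d.$$ Let $k$ be the smallest integer satisfying $k\geq e^h\sqrt{\frac{\cosh(d)-1}{\cosh(w)-1}}$. Then $$\chi(\mathbb{H},d)\leq (k+1)\left(\left\lceil\frac{d}{h}\right\rceil+1\right).$$
   Context: $\mathbb{H}=\{(x,y)\in\mathbb{R}^2 : y>0\}$ is the hyperbolic plane (upper half-plane model) with distance $d_{\mathbb{H}}((x,y),(x',y'))=\operatorname{arccosh}\left(1+\frac{(x-x')^2+(y-y')^2}{2yy'}\right)$. For $d>0$, $\chi(\mathbb{H},d)$ denotes the minimal number of colors needed to color all points of $\mathbb{H}$ so that any two points at hyperbolic distance exactly $d$ receive different colors. *)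

(* Defs.v *)
From Stdlib Require Import Reals Lra ZArith.

Open Scope R_scope.

(* Only meaningful for 1 <= x; see cosh_arccosh and arccosh_nonneg. *)
Definition arccosh (x : R) : R := ln (x + sqrt (x ^ 2 - 1)).

Lemma cosh_arccosh (x : R) : 1 <= x -> cosh (arccosh x) = x.
Proof.
  intros hx. unfold cosh, arccosh.
  assert (h0 : 0 <= x ^ 2 - 1) by nra.
  assert (hs := sqrt_pos (x ^ 2 - 1)).
  assert (hq := sqrt_sqrt _ h0).
  rewrite exp_Ropp, exp_ln by lra.
  replace (/ (x + sqrt (x ^ 2 - 1))) with (x - sqrt (x ^ 2 - 1)).
  - lra.
  - apply Rmult_eq_reg_l with (x + sqrt (x ^ 2 - 1)); [|lra].
    rewrite Rinv_r by lra. nra.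
Qed.

Lemma arccosh_nonneg (x : R) : 1 <= x -> 0 <= arccosh x.
Proof.
  intros hx. unfold arccosh. rewrite <- ln_1.
  assert (hs := sqrt_pos (x ^ 2 - 1)).
  destruct (Req_dec 1 (x + sqrt (x ^ 2 - 1))) as [<-|hne]; [lra|].
  left. apply ln_increasing; lra.
Qed.

Record halfplane : Type := HPoint {
  hp_x : R;
  hp_y : R;
  hp_y_pos : 0 < hp_y
}.

Definition dist_H (p q : halfplane) : R :=
  arccosh (1 + ((hp_x p - hp_x q) ^ 2 + (hp_y p - hp_y q) ^ 2)
               / (2 * hp_y p * hp_y q)).

Definition colorable (d : R) (n : nat) : Prop :=
  exists c : halfplane -> nat,
    (forall p, (c p < n)%nat) /\
    (forall p q, dist_H p q = d -> c p <> c q).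

(* A relation rather than a function, since a priori no finite number of
   colors need suffice: is_chi d n reads "chi(H, d) is finite, equal to n". *)
Definition is_chi (d : R) (n : nat) : Prop :=
  colorable d n /\ (forall m : nat, colorable d m -> (n <= m)%nat).

Definition is_smallest_integer (P : Z -> Prop) (k : Z) : Prop :=
  P k /\ (forall m : Z, P m -> (k <= m)%Z).

(* Main.v *)
(** Cut the half-plane into horizontal strips of hyperbolic height [h], and each
    strip into congruent half-open boxes whose bottom corners are at hyperbolic
    distance [w].  Colour the boxes periodically, with period [k + 1] along a
    strip and period [ceil (d / h) + 1] across the strips.  Two points of one box
    are at distance less than [d] because, with one point on the bottom edge, the
    cosh of the distance is a convex function of the height ratio, so the extreme
    cases are the two terms of the maximum in the hypothesis.  Two points of
    distinct boxes of one colour are at distance more than [d]: either their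
    heights differ by a factor larger than [exp d], or they lie in one strip and
    their abscissae differ by more than [k] box widths. *)

Require Import Defs.
From Stdlib Require Import Reals ZArith Lra Lia Wf_nat Classical.
Open Scope R_scope.

(** * Monotonicity of exp and cosh *)

Lemma exp_le_compat (a b : R) : a <= b -> exp a <= exp b.
Proof.
  intros [hab| ->]; [left; now apply exp_increasing | lra].
Qed.

Lemma cosh_le_compat (a b : R) : 0 <= a -> a <= b -> cosh a <= cosh b.
Proof.
  intros ha hab. unfold cosh. rewrite !exp_Ropp.
  assert (hu : 1 <= exp a) by (pose proof (exp_ineq1_le a); lra).
  assert (huv : exp a <= exp b) by now apply exp_le_compat.
  set (u := exp a) in *. set (v := exp b) in *.
  assert (E : (v + / v) / 2 - (u + / u) / 2 = (v - u) * (u * v - 1) / (2 * u * v)).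
  { field. split; lra. }
  assert (0 <= (v - u) * (u * v - 1) / (2 * u * v)).
  { assert (1 <= u * v) by nra.
    apply Rmult_le_pos; [apply Rmult_le_pos; lra|].
    left. apply Rinv_0_lt_compat. lra. }
  lra.
Qed.

Lemma cosh_gt_1 (a : R) : 0 < a -> 1 < cosh a.
Proof.
  intros ha. unfold cosh. rewrite exp_Ropp.
  assert (hu : 1 < exp a) by (pose proof (exp_ineq1 a); lra).
  set (u := exp a) in *.
  assert (E : (u + / u) / 2 - 1 = (u - 1) * (u - 1) / (2 * u)) by (field; lra).
  assert (0 < (u - 1) * (u - 1) / (2 * u)).
  { apply Rdiv_lt_0_compat; nra. }
  lra.
Qed.

Lemma arccosh_le_cosh (x d : R) : 1 <= x -> arccosh x <= d -> x <= cosh d.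
Proof.
  intros hx hd. rewrite <- (cosh_arccosh x hx).
  apply cosh_le_compat; [now apply arccosh_nonneg | exact hd].
Qed.

(** * The distance equation in polynomial form *)

Lemma dist_H_eq (p q : halfplane) (d : R) :
  dist_H p q = d ->
  (hp_x p - hp_x q) ^ 2 + (hp_y p - hp_y q) ^ 2
  = 2 * (cosh d - 1) * hp_y p * hp_y q.
Proof.
  destruct p as [x y hy], q as [x' y' hy']; unfold dist_H; simpl hp_x; simpl hp_y.
  assert (hpos : 0 < 2 * y * y') by nra.
  intros <-. rewrite cosh_arccosh.
  - field. lra.
  - assert (0 <= ((x - x') ^ 2 + (y - y') ^ 2) / (2 * y * y')); [|lra].
    apply Rmult_le_pos; [apply Rplus_le_le_0_compat; apply pow2_ge_0|].
    left. now apply Rinv_0_lt_compat.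
Qed.

Lemma dist_H_sym (p q : halfplane) : dist_H p q = dist_H q p.
Proof.
  destruct p as [x y hy], q as [x' y' hy']; unfold dist_H; simpl.
  f_equal. f_equal. field. lra.
Qed.

(** Used with [a] = cosh w - 1, [c] = cosh d - 1, [e] = e^h and [y0] the base of the strip. Dividing
    by y^2 leaves q(t) = 2a + (t - 1)^2 - 2ct <= 0 for t = y'/y in [1, e]. As q is convex, the
    endpoints suffice: q(1) <= 0 is [a <= c], and q(e) <= 0 is the diagonal condition. *)
Lemma box_near (a c e y0 y y' x : R) :
  0 < a -> a <= c -> 1 < e -> 2 * a + (e - 1) ^ 2 <= 2 * e * c ->
  0 < y0 -> y0 <= y -> y <= y' -> y' < e * y0 -> x ^ 2 < 2 * a * y0 ^ 2 ->
  x ^ 2 + (y - y') ^ 2 < 2 * c * y * y'.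
Proof.
  intros ha hac he hec hy0 hy hyy' hy' hx.
  assert (hx' : x ^ 2 < 2 * a * y ^ 2).
  { assert (y0 ^ 2 <= y ^ 2) by (apply pow_incr; lra). nra. }
  set (t := y' / y).
  assert (ht : y' = t * y) by (unfold t; field; lra).
  assert (h1 : 1 <= t).
  { apply Rmult_le_reg_r with y; lra. }
  assert (h2 : t <= e).
  { apply Rmult_le_reg_r with y; nra. }
  assert (hg : 2 * a + (t - 1) ^ 2 <= 2 * c * t).
  { (* convexity on [1, e], multiplied by [e - 1] *)
    apply Rmult_le_reg_l with (e - 1); [lra|].
    assert (0 <= (e - t) * (c - a)) by (apply Rmult_le_pos; lra).
    assert (0 <= (t - 1) * (2 * e * c - 2 * a - (e - 1) ^ 2))
      by (apply Rmult_le_pos; lra).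
    assert (0 <= (e - 1) * ((t - 1) * (e - t)))
      by (repeat apply Rmult_le_pos; lra).
    nra. }
  rewrite ht.
  assert (y ^ 2 * (2 * a + (t - 1) ^ 2) <= y ^ 2 * (2 * c * t))
    by (apply Rmult_le_compat_l; [nra | exact hg]).
  nra.
Qed.

(** The equation reads (y' - e^d y)(y' - e^(-d) y) = -x^2, so y' lies between the two roots e^(-d) y
    and e^d y. *)
Lemma height_ratio_le (d y y' x : R) :
  0 < d -> 0 < y -> 0 < y' ->
  x ^ 2 + (y - y') ^ 2 = 2 * (cosh d - 1) * y * y' ->
  y' <= exp d * y.
Proof.
  intros hd hy hy' E. unfold cosh in E. rewrite exp_Ropp in E.
  assert (hu : 1 < exp d) by (pose proof (exp_ineq1 d); lra).
  set (u := exp d) in *.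
  assert (hv : / u < 1) by (rewrite <- Rinv_1; apply Rinv_lt_contravar; lra).
  assert (F : (y' - u * y) * (y' - / u * y) = - x ^ 2).
  { transitivity (y' ^ 2 + y ^ 2 - (u + / u) * y * y'); [field; lra | lra]. }
  destruct (Rle_or_lt y' (u * y)) as [|hlt]; [assumption|].
  assert (0 < y' - / u * y) by nra.
  nra.
Qed.

(** * Periodic colourings and the chromatic number *)

Lemma mod_eq_lt (a b n : Z) :
  (0 < n)%Z -> (a mod n = b mod n)%Z -> (a < b)%Z -> (a + n <= b)%Z.
Proof.
  intros hn e hlt.
  pose proof (Z.div_mod a n ltac:(lia)). pose proof (Z.div_mod b n ltac:(lia)).
  assert (a / n < b / n)%Z by nia.
  nia.
Qed.

Lemma colorable_of_residues (d : R) (K M : Z) (f g : halfplane -> Z) :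
  (0 < K)%Z -> (0 < M)%Z ->
  (forall p q, dist_H p q = d ->
     (f p mod K = f q mod K)%Z -> (g p mod M = g q mod M)%Z -> False) ->
  colorable d (Z.to_nat (K * M)).
Proof.
  intros hK hM hfg.
  (* Mixed radix: the colour determines both residues. *)
  exists (fun p => Z.to_nat (f p mod K + K * (g p mod M))).
  assert (hf := fun p => Z.mod_pos_bound (f p) K hK).
  assert (hg := fun p => Z.mod_pos_bound (g p) M hM).
  split.
  - intros p. specialize (hf p). specialize (hg p). apply Z2Nat.inj_lt; nia.
  - intros p q hpq e. pose proof (hf p). pose proof (hf q).
    pose proof (hg p). pose proof (hg q).
    apply Z2Nat.inj in e; [|nia|nia].
    assert (g p mod M = g q mod M)%Z by nia.
    apply (hfg p q hpq); nia.
Qed.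

(** One finite colouring makes the chromatic number exist, by well-ordering; excluded middle stands
    in for a decision procedure for [colorable]. *)
Lemma is_chi_le (d : R) (n : nat) :
  colorable d n -> exists m, is_chi d m /\ (m <= n)%nat.
Proof.
  intros hn.
  destruct (dec_inh_nat_subset_has_unique_least_element (colorable d))
    as [m [[hm hmin] _]].
  - intros m. apply classic.
  - now exists n.
  - exists m. split; [split|]; auto.
Qed.

(** * Strips and boxes *)

Definition strip (h : R) (p : halfplane) : Z := Zfloor (ln (hp_y p) / h).

Definition strip_base (h : R) (j : Z) : R := exp (h * IZR j).

(** At height y0 = [strip_base], a horizontal step y0 s with s^2 = 2 (cosh w - 1) has hyperbolic
    length w, since (y0 s)^2 / (2 y0^2) = cosh w - 1. *)
Definition box (h w : R) (p : halfplane) : Z :=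
  Zfloor (hp_x p / (strip_base h (strip h p) * sqrt (2 * (cosh w - 1)))).

Lemma strip_bounds (h : R) (p : halfplane) :
  0 < h ->
  strip_base h (strip h p) <= hp_y p < exp h * strip_base h (strip h p).
Proof.
  intros hh. unfold strip_base, strip.
  destruct (Zfloor_bound (ln (hp_y p) / h)) as [h1 h2].
  assert (hl : hp_y p = exp (ln (hp_y p)))
    by (symmetry; apply exp_ln, hp_y_pos).
  set (l := ln (hp_y p)) in *.
  assert (E : l = h * (l / h)) by (field; lra).
  rewrite hl, <- exp_plus.
  split; [apply exp_le_compat | apply exp_increasing]; nra.
Qed.

(** At least ceil(d / h) whole strips lie between the points, of total height at least d. The open
    top edge of the strip of [p] makes the height ratio exceed e^d strictly. *)
Lemma strip_far (d h : R) (p q : halfplane) :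
  0 < d -> 0 < h -> dist_H p q = d ->
  (strip h p + (Zceil (d / h) + 1) <= strip h q)%Z -> False.
Proof.
  intros hd hh hpq hle.
  apply dist_H_eq in hpq.
  apply height_ratio_le in hpq; try apply hp_y_pos; [|exact hd].
  destruct (strip_bounds h p hh) as [_ hp].
  destruct (strip_bounds h q hh) as [hq _].
  apply IZR_le in hle. rewrite !plus_IZR in hle.
  destruct (Zceil_bound (d / h)) as [_ hc].
  assert (hdh : d <= h * IZR (Zceil (d / h))).
  { replace d with (h * (d / h)) at 1 by (field; lra).
    apply Rmult_le_compat_l; lra. }
  assert (hexp : exp d * (exp h * strip_base h (strip h p))
                 <= strip_base h (strip h q)).
  { unfold strip_base. rewrite <- !exp_plus. apply exp_le_compat. nra. }
  pose proof (exp_pos d). nra.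
Qed.

Lemma box_bounds (h w : R) (p : halfplane) (s := sqrt (2 * (cosh w - 1))) :
  0 < w ->
  IZR (box h w p) * (strip_base h (strip h p) * s) <= hp_x p
  < (IZR (box h w p) + 1) * (strip_base h (strip h p) * s).
Proof.
  intros hw. unfold box. fold s.
  assert (hs : 0 < s) by (apply sqrt_lt_R0; pose proof (cosh_gt_1 w hw); lra).
  assert (hW : 0 < strip_base h (strip h p) * s)
    by (apply Rmult_lt_0_compat; [apply exp_pos | exact hs]).
  set (W := _ * s) in *.
  destruct (Zfloor_bound (hp_x p / W)) as [h1 h2].
  replace (hp_x p) with (hp_x p / W * W) at 2 3 by (field; lra).
  split; [apply Rmult_le_compat_r | apply Rmult_lt_compat_r]; lra.
Qed.

(** At least k whole boxes lie between the points. The factor e^h in the bound on k pays for the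
    heights, which may approach e^h times the base, where a box is hyperbolically narrowest. *)
Lemma box_far (d w h : R) (k : Z) (p q : halfplane) :
  0 < d -> 0 < w -> 0 < h ->
  IZR k >= exp h * sqrt ((cosh d - 1) / (cosh w - 1)) ->
  dist_H p q = d -> strip h p = strip h q ->
  (box h w p + (k + 1) <= box h w q)%Z -> False.
Proof.
  intros hd hw hh hk hpq hs hle.
  apply dist_H_eq in hpq.
  destruct (strip_bounds h p hh) as [hp1 hp2].
  destruct (strip_bounds h q hh) as [hq1 hq2].
  destruct (box_bounds h w p hw) as [_ hbp].
  destruct (box_bounds h w q hw) as [hbq _].
  rewrite <- hs in *.
  assert (hy0 : 0 < strip_base h (strip h p)) by apply exp_pos.
  set (y0 := strip_base _ _) in *.
  apply IZR_le in hle. rewrite !plus_IZR in hle.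
  pose proof (cosh_gt_1 w hw). pose proof (cosh_gt_1 d hd).
  pose proof (exp_pos h).
  assert (hr : 0 < (cosh d - 1) / (cosh w - 1)) by (apply Rdiv_lt_0_compat; lra).
  pose proof (sqrt_lt_R0 _ hr) as hsr0.
  pose proof (sqrt_sqrt _ (Rlt_le _ _ hr)) as hsr.
  set (r := sqrt ((cosh d - 1) / (cosh w - 1))) in *.
  assert (hs0 : 0 < 2 * (cosh w - 1)) by lra.
  pose proof (sqrt_lt_R0 _ hs0) as hss0.
  pose proof (sqrt_sqrt _ (Rlt_le _ _ hs0)) as hss.
  set (s := sqrt (2 * (cosh w - 1))) in *.
  (* The width w cancels here, leaving the constant of the distance equation. *)
  assert (hrs : (r * s) ^ 2 = 2 * (cosh d - 1)).
  { replace ((r * s) ^ 2) with ((r * r) * (s * s)) by ring.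
    rewrite hsr, hss. field. lra. }
  assert (hx : exp h * y0 * (r * s) <= hp_x q - hp_x p).
  { assert (0 < y0 * s) by nra.
    assert (IZR k * (y0 * s) <= hp_x q - hp_x p) by nra.
    assert (exp h * r * (y0 * s) <= IZR k * (y0 * s))
      by (apply Rmult_le_compat_r; lra).
    lra. }
  assert (hx2 : (exp h * y0 * (r * s)) ^ 2 <= (hp_x q - hp_x p) ^ 2).
  { apply pow_incr. split; [|exact hx].
    repeat apply Rmult_le_pos; lra. }
  assert (hyy : hp_y p * hp_y q < (exp h * y0) * (exp h * y0))
    by (apply Rmult_gt_0_lt_compat; try apply Rlt_gt; try apply hp_y_pos; nra).
  rewrite Rpow_mult_distr, hrs in hx2.
  assert (2 * (cosh d - 1) * (hp_y p * hp_y q)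
          < 2 * (cosh d - 1) * ((exp h * y0) * (exp h * y0)))
    by (apply Rmult_lt_compat_l; lra).
  pose proof (pow2_ge_0 (hp_y p - hp_y q)).
  nra.
Qed.

Lemma same_box_near (d w h : R) (p q : halfplane) :
  0 < w -> 0 < h -> w <= d ->
  2 * (cosh w - 1) + (exp h - 1) ^ 2 <= 2 * exp h * (cosh d - 1) ->
  dist_H p q = d -> strip h p = strip h q -> box h w p = box h w q ->
  hp_y p <= hp_y q -> False.
Proof.
  intros hw hh hwd hdiag hpq hs hb hyy.
  apply dist_H_eq in hpq.
  destruct (strip_bounds h p hh) as [hp1 hp2].
  destruct (strip_bounds h q hh) as [hq1 hq2].
  pose proof (box_bounds h w p hw) as hbp.
  pose proof (box_bounds h w q hw) as hbq.
  rewrite <- hs in *. rewrite <- hb in *.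
  assert (hy0 : 0 < strip_base h (strip h p)) by apply exp_pos.
  set (y0 := strip_base _ _) in *.
  pose proof (cosh_gt_1 w hw).
  assert (hs0 : 0 <= 2 * (cosh w - 1)) by lra.
  pose proof (sqrt_sqrt _ hs0) as hss.
  set (s := sqrt (2 * (cosh w - 1))) in *.
  (* Both abscissae lie in one half-open interval of length y0 s, hence the strict bound. *)
  assert (hx : (hp_x p - hp_x q) ^ 2 < 2 * (cosh w - 1) * y0 ^ 2).
  { rewrite <- hss. replace (s * s * y0 ^ 2) with ((y0 * s) ^ 2) by ring. nra. }
  pose proof (cosh_le_compat w d ltac:(lra) hwd).
  pose proof (exp_ineq1 h ltac:(lra)).
  pose proof (box_near (cosh w - 1) (cosh d - 1) (exp h) y0 (hp_y p) (hp_y q)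
    (hp_x p - hp_x q) ltac:(lra) ltac:(lra) ltac:(lra) hdiag hy0 hp1 hyy hq2 hx).
  lra.
Qed.

Theorem mainTheorem5 (d w h : R) (k : Z)
  (hd : 0 < d) (hw : 0 < w) (hh : 0 < h)
  (hmax : Rmax w (arccosh (1 + (2 * (cosh w - 1) + (exp h - 1) ^ 2)
                               / (2 * exp h))) <= d)
  (hk : is_smallest_integer
          (fun m : Z => IZR m >= exp h * sqrt ((cosh d - 1) / (cosh w - 1))) k) :
  exists n : nat,
    is_chi d n /\ (Z.of_nat n <= (k + 1) * (Zceil (d / h) + 1))%Z.
Proof.
  destruct hk as [hk _].
  pose proof (Rle_trans _ _ _ (Rmax_l _ _) hmax) as hwd.
  pose proof (Rle_trans _ _ _ (Rmax_r _ _) hmax) as hdiag.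
  clear hmax.
  pose proof (exp_pos h). pose proof (cosh_gt_1 w hw).
  assert (hdiag' :
    2 * (cosh w - 1) + (exp h - 1) ^ 2 <= 2 * exp h * (cosh d - 1)).
  { assert (0 <= (2 * (cosh w - 1) + (exp h - 1) ^ 2) / (2 * exp h)).
    { pose proof (pow2_ge_0 (exp h - 1)). left. apply Rdiv_lt_0_compat; lra. }
    apply arccosh_le_cosh in hdiag; [|lra].
    set (D := 2 * (cosh w - 1) + (exp h - 1) ^ 2) in *.
    replace D with (2 * exp h * (D / (2 * exp h))) by (field; lra).
    apply Rmult_le_compat_l; lra. }
  (* Both periods must be positive for the residues to be bounded. *)
  assert (hK : (0 < k + 1)%Z).
  { assert (0 <= k)%Z; [|lia]. apply le_IZR.
    pose proof (sqrt_pos ((cosh d - 1) / (cosh w - 1))). nra. }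
  assert (hM : (0 < Zceil (d / h) + 1)%Z).
  { assert (0 < Zceil (d / h))%Z; [|lia]. apply lt_IZR.
    pose proof (Rdiv_lt_0_compat d h hd hh).
    destruct (Zceil_bound (d / h)). lra. }
  destruct (is_chi_le d (Z.to_nat ((k + 1) * (Zceil (d / h) + 1))))
    as [n [hn hle]].
  - apply (colorable_of_residues d _ _ (box h w) (strip h) hK hM).
    intros p q hpq hbm hsm.
    (* The lemmas assume an order on strips, boxes or heights; symmetry of the distance covers the
       reversed cases. *)
    pose proof hpq as hqp. rewrite dist_H_sym in hqp.
    destruct (Z.lt_trichotomy (strip h p) (strip h q)) as [hs|[hs|hs]].
    + apply (strip_far d h p q hd hh hpq). now apply mod_eq_lt.
    + destruct (Z.lt_trichotomy (box h w p) (box h w q)) as [hb|[hb|hb]].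
      * apply (box_far d w h k p q hd hw hh hk hpq hs). now apply mod_eq_lt.
      * destruct (Rle_or_lt (hp_y p) (hp_y q)) as [hy|hy].
        -- now apply (same_box_near d w h p q).
        -- apply (same_box_near d w h q p); auto. lra.
      * apply (box_far d w h k q p hd hw hh hk hqp (eq_sym hs)).
        now apply mod_eq_lt.
    + apply (strip_far d h q p hd hh hqp). now apply mod_eq_lt.
  - exists n. split; [exact hn|]. nia.
Qed.
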